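(* Let $\Gamma$ be a connected trivalent graph and let $G\le \mathrm{Aut}(\Gamma)$ act vertex- and arc-transitively on $\Gamma$, with infinite vertex stabilizers. Then $\Gamma$ is a tree. Furthermore, $G$ acts transitively on the set of $s$-arcs of $\Gamma$ for every $s\ge 1$, and if $G$ is a closed subgroup of $\mathrm{Aut}(\Gamma)$ then $G$ acts $2$-transitively on the set of ends of $\Gamma$.
   Context: Graphs are simple. An arc is an ordered pair $(\alpha,\beta)$ with $\{\alpha,\beta\}$ an edge. An $s$-arc is a tuple $(\alpha_0,\dots,\alpha_s)$ of vertices with each $(\alpha_i,\alpha_{i+1})$ an arc and $\alpha_{i-1}\ne\alpha_{i+1}$ for $1\le i\le s-1$. A sequence of permutations $g_i$ of a set $\Omega$ converges to a permutation $g$ if for each $\alpha\in\Omega$, $\alpha g_i=\alpha g$ for all sufficiently large $i$; a group of permutations of the vertex set is closed if it contains the limit of every convergent sequence of its elements. A ray is a one-way infinite path $\alpha_0,\alpha_1,\dots$ of distinct vertices; two rays are equivalent if some third ray meets both in infinitely many vertices; the ends of $\Gamma$ are the equivalence classes of rays, and $\mathrm{Aut}(\Gamma)$ acts on them. *)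

(* Defs.v *)
From mathcomp Require Import all_boot.
From mathcomp Require Import all_classical.
Set Implicit Arguments.
Unset Strict Implicit.
Unset Printing Implicit Defensive.
Local Open Scope classical_set_scope.
Local Open Scope card_scope.

(* The boolean adjacency relation is no restriction, since the development is
   classical: a Prop-valued relation can be reflected with asbool. *)
Record graph := Graph {
  vertex :> Type;
  adj : rel vertex;
  adj_sym : symmetric adj;
  adj_irrefl : irreflexive adj
}.

Section Graphs.
Variable Gamma : graph.
Implicit Types (x y : Gamma) (g h : Gamma -> Gamma) (G : set (Gamma -> Gamma)).

Definition neighbours x : set Gamma := [set y | adj x y].

Definition connected_graph : Prop :=
  inhabited Gamma /\
  forall x y, exists2 p : seq Gamma, path (@adj Gamma) x p & last x p = y.

Definition trivalent : Prop := forall x, neighbours x #= `I_3.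

(* ordS is the cyclic successor on 'I_n. *)
Definition is_cycle n (c : 'I_n -> Gamma) : Prop :=
  [/\ 3 <= n, injective c & forall i, adj (c i) (c (ordS i))].

Definition is_tree : Prop :=
  connected_graph /\ forall n (c : 'I_n -> Gamma), ~ is_cycle c.

Definition is_automorphism g : Prop :=
  bijective g /\ forall x y, adj (g x) (g y) = adj x y.

(* Permutations are represented by their underlying functions; by functional
   extensionality, equality of functions is equality of permutations. *)
Definition subgroup_Aut G : Prop :=
  [/\ forall g, G g -> is_automorphism g,
      G idfun,
      forall g h, G g -> G h -> G (g \o h)
    & forall g h, G g -> cancel g h -> cancel h g -> G h].

Definition stabilizer G x : set (Gamma -> Gamma) := [set g | G g /\ g x = x].

Definition vertex_transitive G : Prop :=
  forall x y, exists2 g, G g & g x = y.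

Definition arc_transitive G : Prop :=
  forall x y x' y', adj x y -> adj x' y' ->
  exists2 g, G g & g x = x' /\ g y = y'.

Definition is_sarc s (a : 'I_s.+1 -> Gamma) : Prop :=
  (forall i j : 'I_s.+1, j = i.+1 :> nat -> adj (a i) (a j)) /\
  (forall i j : 'I_s.+1, j = i.+2 :> nat -> a i <> a j).

Definition sarc_transitive G s : Prop :=
  forall a b : 'I_s.+1 -> Gamma, is_sarc a -> is_sarc b ->
  exists2 g, G g & forall i, g (a i) = b i.

Definition perm_converges (u : nat -> Gamma -> Gamma) g : Prop :=
  forall x, exists N, forall n, N <= n -> u n x = g x.

Definition closed_group G : Prop :=
  forall (u : nat -> Gamma -> Gamma) g,
  (forall n, G (u n)) -> bijective g -> perm_converges u g -> G g.

Definition is_ray (r : nat -> Gamma) : Prop :=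
  injective r /\ forall n, adj (r n) (r n.+1).

Definition ray_equiv (r1 r2 : nat -> Gamma) : Prop :=
  exists t, [/\ is_ray t, infinite_set (range t `&` range r1)
                        & infinite_set (range t `&` range r2)].

Definition end_of (r : nat -> Gamma) : set (nat -> Gamma) :=
  [set r' | is_ray r' /\ ray_equiv r r'].

Definition ends : set (set (nat -> Gamma)) := end_of @` [set r | is_ray r].

Definition end_act g (e : set (nat -> Gamma)) : set (nat -> Gamma) :=
  [set g \o r | r in e].

Definition two_transitive_on_ends G : Prop :=
  forall e1 e2 f1 f2, ends e1 -> ends e2 -> ends f1 -> ends f2 ->
  e1 <> e2 -> f1 <> f2 ->
  exists2 g, G g & end_act g e1 = f1 /\ end_act g e2 = f2.

End Graphs.

Arguments connected_graph : clear implicits.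
Arguments trivalent : clear implicits.
Arguments is_tree : clear implicits.

(* Main.v *)
Require Import Defs.
From mathcomp Require Import all_boot.
From mathcomp Require Import all_classical.
From mathcomp Require Import zify.

Set Implicit Arguments.
Unset Strict Implicit.
Unset Printing Implicit Defensive.

(** If G is s-arc-transitive but not (s+1)-arc-transitive, the stabilizer of an
    s-arc cannot swap the two one-step prolongations at either end, so it fixes
    them, and by connectedness it fixes every vertex. It is then trivial, while
    having finite index in a vertex stabilizer, which contradicts the
    infiniteness of the latter. Hence G is s-arc-transitive for all s >= 1.

    An s-arc that returns to its starting vertex can be rerouted at one endpoint
    into one that does not, so s-arc-transitivity excludes closed s-arcs: the
    graph is a tree, and inequivalent rays have tails that are the two halves of
    a bi-infinite line. Given two such lines, s-arc-transitivity yields for each n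
    an element of G matching their central segments of length 2n; by local
    finiteness these elements accumulate at a permutation matching the whole
    lines, which belongs to G when G is closed. *)

(** * Neighbourhoods in a trivalent graph *)

Section Trivalent.
Variable Gamma : graph.
Hypothesis htri : trivalent Gamma.
Implicit Types (x y z w : Gamma) (f h : nat -> Gamma).

Lemma neighbours_enum x : exists a b c : Gamma,
  [/\ a <> b, a <> c & b <> c] /\
  forall y, adj x y <-> [\/ y = a, y = b | y = c].
Proof.
have /card_set_bijP[F [Ffun Finj Fsurj]] := htri x.
have [a /= xa Fa] : (F @` neighbours x)%classic 0 by apply: Fsurj.
have [b /= xb Fb] : (F @` neighbours x)%classic 1 by apply: Fsurj.
have [c /= xc Fc] : (F @` neighbours x)%classic 2 by apply: Fsurj.
exists a, b, c; split; first by split=> e; move: Fa Fb Fc; rewrite e; lia.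
move=> y; split=> [xy|[]->//].
have inj z : adj x z -> F y = F z -> y = z.
  by move=> xz; apply: Finj; rewrite inE.
have /= := Ffun y xy; case E: (F y) => [|[|[|//]]] _.
- by apply: Or31; apply: inj => //; rewrite Fa.
- by apply: Or32; apply: inj => //; rewrite Fb.
- by apply: Or33; apply: inj => //; rewrite Fc.
Qed.

Lemma third_neighbour x y z : exists2 w, adj x w & w <> y /\ w <> z.
Proof.
have [a [b [c [[ab ac bc] nE]]]] := neighbours_enum x.
have xa : adj x a by apply/nE; apply: Or31.
have xb : adj x b by apply/nE; apply: Or32.
have xc : adj x c by apply/nE; apply: Or33.
have [ay|ay] := pselect (a = y); have [az|az] := pselect (a = z).
- by exists b => //; split; congruence.
- have [bz|bz] := pselect (b = z); last by exists b => //; split; congruence.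
  by exists c => //; split; congruence.
- have [bz|bz] := pselect (b = y); last by exists b => //; split; congruence.
  by exists c => //; split; congruence.
- by exists a.
Qed.

Lemma adj_distinct3 x a b c y : adj x a -> adj x b -> adj x c ->
  a <> b -> a <> c -> b <> c -> adj x y -> [\/ y = a, y = b | y = c].
Proof.
have [p [q [r [_ nE]]]] := neighbours_enum x.
by move=> /nE[]-> /nE[]-> /nE[]-> ? ? ? /nE[]-> //;
  first [by apply: Or31 | by apply: Or32 | by apply: Or33].
Qed.

Lemma finite_neighbours x : finite_set (neighbours x).
Proof. by exists 3; apply: htri. Qed.

End Trivalent.

(** * Non-backtracking walks and their concatenation *)

Section NonBacktracking.
Variable Gamma : graph.
Implicit Types (x y z w : Gamma) (f h : nat -> Gamma) (g : Gamma -> Gamma).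

(* An s-arc as the first s + 1 values of a sequence. *)
Definition nbwalk s f : Prop :=
  (forall i, i < s -> adj (f i) (f i.+1)) /\
  (forall i, i.+1 < s -> f i <> f i.+2).

Definition scons w f i : Gamma := if i is j.+1 then f j else w.

(* The walk f traversed backwards from f m to f 0 = h 0, then h. *)
Definition glue m f h i : Gamma := if i <= m then f (m - i) else h (i - m).

Lemma nbwalk_le t s f : t <= s -> nbwalk s f -> nbwalk t f.
Proof. by move=> ts [fa fb]; split=> i it; [apply: fa|apply: fb]; lia. Qed.

Lemma nbwalk_shift k s f : nbwalk (k + s) f -> nbwalk s (fun i => f (k + i)).
Proof.
move=> [fa fb]; split=> i it; rewrite !addnS; first by apply: fa; lia.
by apply: fb; lia.
Qed.

Lemma nbwalk_rev s f : nbwalk s f -> nbwalk s (fun i => f (s - i)).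
Proof.
move=> [fa fb]; split=> i it.
  by rewrite adj_sym (_ : s - i = (s - i.+1).+1); [apply: fa|]; lia.
by apply/nesym; rewrite (_ : s - i = (s - i.+2).+2); [apply: fb|]; lia.
Qed.

Lemma nbwalk_scons s w f : nbwalk s f -> adj w (f 0) -> (0 < s -> w <> f 1) ->
  nbwalk s.+1 (scons w f).
Proof.
move=> [fa fb] wf0 wf1; split=> -[|i] /= it //; first exact: fa.
  by apply: wf1; lia.
by apply: fb; lia.
Qed.

Lemma nbwalk_comp s g f : is_automorphism g -> nbwalk s f ->
  nbwalk s (fun i => g (f i)).
Proof.
move=> [/bij_inj ginj gadj] [fa fb]; split=> i it; first by rewrite gadj fa.
by move/ginj; apply: fb.
Qed.

(** The walk passes [f 1], [f 0 = h 0], [h 1] at the junction, so [f 1 <> h 1] rules out the only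
    new backtracking. *)
Lemma nbwalk_glue m n f h : nbwalk m f -> nbwalk n h -> f 0 = h 0 ->
  f 1 <> h 1 -> nbwalk (m + n) (glue m f h).
Proof.
move=> fP [ha hb] fh0 fh1; have [ra rb] := nbwalk_rev fP; rewrite /glue.
have gE i : (m <= i) -> (if i <= m then f (m - i) else h (i - m)) = h (i - m).
  move=> mi; case: ifP => // im.
  by rewrite (_ : i = m) ?subnn //; lia.
split=> i it.
  have [im|mi] := ltnP i m; first by rewrite (ltnW im) ra.
  rewrite !gE; [|lia..].
  by rewrite subSn //; apply: ha; lia.
have [im|mi] := ltnP i.+1 m; first by rewrite (_ : i <= m); [apply: rb|lia].
have [im|mi'] := leqP m i.
  rewrite !gE; [|lia..].
  by rewrite (_ : i.+2 - m = (i - m).+2); [apply: hb|]; lia.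
have -> : (i <= m) = true by lia.
have -> : m - i = 1 by lia.
by have -> : i.+2 - m = 1 by lia.
Qed.

End NonBacktracking.

(** * The action of [G] on walks *)

Section Group.
Variables (Gamma : graph) (G : set (Gamma -> Gamma)).
Hypotheses (hconn : connected_graph Gamma) (htri : trivalent Gamma).
Hypothesis hG : subgroup_Aut G.
Implicit Types (x y z w : Gamma) (f h k : nat -> Gamma) (g : Gamma -> Gamma).

Lemma subgroup_inv g : G g -> exists2 g', G g' & cancel g g' /\ cancel g' g.
Proof.
have [Gaut _ _ Ginv] := hG; move=> Gg.
have [[g' gK g'K] _] := Gaut g Gg.
by exists g' => //; apply: Ginv gK g'K.
Qed.

Lemma subgroup_injective g : G g -> injective g.
Proof. by case: hG => + _ _ _ => /[apply] -[/bij_inj]. Qed.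

Lemma subgroup_adj g x y : G g -> adj (g x) (g y) = adj x y.
Proof. by case: hG => + _ _ _ => /[apply] -[_ ->]. Qed.

Lemma connected_ind (P : Gamma -> Prop) x0 : P x0 ->
  (forall x y, P x -> adj x y -> P y) -> forall x, P x.
Proof.
move=> P0 PS x; have [p + <-] := hconn.2 x0 x.
by elim: p x0 P0 => //= y p IH x0 Px0 /andP[x0y]; apply: IH; apply: PS x0y.
Qed.

Definition nbwalk_transitive s : Prop := forall f h, nbwalk s f -> nbwalk s h ->
  exists2 g, G g & forall i, i <= s -> g (f i) = h i.

Lemma sarc_transitiveP s : sarc_transitive G s <-> nbwalk_transitive s.
Proof.
split=> [tr f h [fa fb] [ha hb]|tr a b [aa ab] [ba bb]].
  have [||g Gg gE] := tr (fun i : 'I_s.+1 => f i) (fun i : 'I_s.+1 => h i).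
  - by split=> i [j js] /= ji; subst j; [apply: fa|apply: fb]; lia.
  - by split=> i [j js] /= ji; subst j; [apply: ha|apply: hb]; lia.
  by exists g => // i si; exact: (gE (Ordinal (si : i < s.+1))).
have walk (c : 'I_s.+1 -> Gamma) : is_sarc c -> nbwalk s (fun i => c (inord i)).
  move=> [ca cb]; split=> i it.
    by apply: ca; rewrite !inordK; lia.
  by apply: cb; rewrite !inordK; lia.
have [//|//|g Gg gE] := tr _ _ (walk a _) (walk b _).
exists g => // i.
by have := gE i; rewrite inord_val; apply; rewrite -ltnS.
Qed.

(** * Pointwise stabilizers of walks *)

Definition fixes s f g : Prop := G g /\ forall i, i <= s -> g (f i) = f i.

Definition rigid_at_start s f : Prop :=
  forall g, fixes s f g -> forall w, adj (f 0) w -> g w = w.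

(** Let [f], [h] be non-conjugate walks of length [s + 1], and let [g0] carry [f] to [h] except at
    index 0. Then [g0 (f 0)] and [h 0] are the two neighbours of [h 1] other than [h 2], and no
    element fixing the rest of [h] maps the first to the second; so such an element fixes all three
    neighbours. *)
Lemma rigid_walk_exists s : 0 < s -> nbwalk_transitive s ->
  ~ nbwalk_transitive s.+1 -> exists2 k, nbwalk s k & rigid_at_start s k.
Proof.
move=> s0 tr ntr; apply: contrapT => norigid; apply: ntr => f h fP hP.
apply: contrapT => nog; apply: norigid.
have [g0 Gg0 g0E] := tr _ _ (nbwalk_shift (k := 1) fP) (nbwalk_shift (k := 1) hP).
exists (fun i => h (1 + i)); first exact: (nbwalk_shift (k := 1) hP).
have [Gaut G1 GM _] := hG.
have nomove g : fixes s (fun i => h (1 + i)) g -> g (g0 (f 0)) <> h 0.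
  move=> [Gg gE] e; apply: nog; exists (g \o g0); first exact: GM.
  by move=> [|i] /= si //; rewrite g0E // gE.
have [ha hb] := hP; have [fa fb] := fP.
pose a := g0 (f 0).
have ea : adj (h 1) a by rewrite -(g0E 0) // subgroup_adj // adj_sym; apply: fa.
have eb : adj (h 1) (h 0) by rewrite adj_sym; apply: ha.
have ec : adj (h 1) (h 2) by apply: ha; lia.
have ab : a <> h 0 by apply: (nomove idfun).
have ac : a <> h 2.
  by rewrite -(g0E 1) // => /(subgroup_injective Gg0); apply: fb; lia.
have bc : h 0 <> h 2 by apply: hb; lia.
move=> g gF w hw; have [Gg gE] := gF.
have gh1 : g (h 1) = h 1 by apply: (gE 0).
have gh2 : g (h 2) = h 2 by apply: (gE 1).
have gnb y : adj (h 1) y -> [\/ g y = a, g y = h 0 | g y = h 2].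
  move=> hy; apply: (adj_distinct3 htri ea eb ec ab ac bc).
  by rewrite -gh1 subgroup_adj.
have gin := subgroup_injective Gg.
have ga : g a = a.
  case: (gnb a ea) => // [/nomove//|]; rewrite -{1}gh2 => /gin; exact.
have gb : g (h 0) = h 0.
  case: (gnb _ eb) => //; first by rewrite -{1}ga => /gin /esym.
  by rewrite -{1}gh2 => /gin.
by case: (adj_distinct3 htri ea eb ec ab ac bc hw) => ->.
Qed.

(** Conjugation by an element carrying [k] to [f] transports rigidity. *)
Lemma rigid_walks s k : nbwalk_transitive s -> nbwalk s k ->
  rigid_at_start s k -> forall f, nbwalk s f -> rigid_at_start s f.
Proof.
move=> tr kP kR f fP g [Gg gE] w fw.
have [_ _ GM _] := hG.
have [g0 Gg0 g0E] := tr _ _ kP fP.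
have [g1 Gg1 [g0K g1K]] := subgroup_inv Gg0.
apply: (can_inj g1K).
have := kR (g1 \o (g \o g0)); rewrite /fixes => /(_ _ (g1 w)) /=.
rewrite g1K; apply.
  by split; [do 2!apply: (GM) => //|move=> i si /=; rewrite g0E // gE // -g0E // g0K].
by rewrite -(subgroup_adj _ _ Gg0) g1K g0E.
Qed.

(** The starting vertices of [s]-walks fixed by [g] are closed under adjacency: by rigidity a
    neighbour [w] of the start is fixed, and prepending it while dropping the last vertex gives a
    new fixed walk, unless this backtracks. *)
Lemma rigid_fixes_id s f g : 0 < s -> nbwalk s f ->
  (forall f', nbwalk s f' -> rigid_at_start s f') -> fixes s f g -> g = idfun.
Proof.
move=> s0 fP R gF; have [Gg gE] := gF; apply: funext.
suff H x : exists2 f', nbwalk s f' & f' 0 = x /\ fixes s f' g.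
  by move=> x; have [f' _ [<- [_ ->]]] := H x.
move: x; apply: (@connected_ind _ (f 0)); first by exists f.
move=> x w [{gF gE fP}f fP [<- gF]] fw; have [_ gE] := gF.
have [wf1|wf1] := pselect (w = f 1); last first.
  exists (scons w f).
    by apply: (@nbwalk_le _ _ s.+1) => //; apply: nbwalk_scons; rewrite // adj_sym.
  split=> //; split=> // -[|i] /= si; first exact: (R f).
  by apply: gE; lia.
(* To step back to f 1, prolong f beyond its far end and drop f 0. *)
have [v fv [vf _]] := third_neighbour htri (f s) (f s.-1) (f s.-1).
have rP := nbwalk_rev fP.
have rF : fixes s (fun i => f (s - i)) g.
  by split=> // i si; apply: gE; lia.
have gv : g v = v by apply: (R _ rP _ rF); rewrite subn0.
exists (fun i => scons v (fun i => f (s - i)) (s - i)).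
  apply/nbwalk_rev/(@nbwalk_le _ _ s.+1) => //.
  by apply: nbwalk_scons; rewrite ?subn0 ?subn1 // adj_sym.
split.
  by rewrite subn0 -(prednK s0) /= wf1; congr f; lia.
split=> // i si; case: (s - i) => [|j] //=.
by apply: gE; lia.
Qed.

(** Lengthening a walk by one vertex cuts its fixator down by a finite index: the elements fixing
    the shorter walk split by the image of the new vertex, a neighbour of [f s], and each nonempty
    class is a coset of the smaller fixator. *)
Lemma finite_stabilizer_of_walk s f : nbwalk s f -> finite_set (fixes s f) ->
  finite_set (stabilizer G (f 0)).
Proof.
have [_ _ GM _] := hG.
have -> : stabilizer G (f 0) = fixes 0 f.
  apply/seteqP; split=> g [Gg gE]; split=> //; last exact: gE.
  by move=> i; rewrite leqn0 => /eqP->.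
elim: s => // s IH fP fin; apply: IH; first exact: nbwalk_le fP.
apply: (@sub_finite_set _ _ (\bigcup_(y in neighbours (f s))
    [set g | fixes s f g /\ g (f s.+1) = y])%classic).
  move=> g gF; exists (g (f s.+1)) => //=.
  have [Gg gE] := gF; rewrite /neighbours /= -[X in adj X _]gE // subgroup_adj //.
  by apply: fP.1.
apply: bigcup_finite; first exact: finite_neighbours.
move=> y _.
have [[g0 [[Gg0 g0E] g0y]]|none] := pselect
    (exists g0, fixes s f g0 /\ g0 (f s.+1) = y); last first.
  apply: (sub_finite_set _ (finite_set0 _)) => g gP.
  by apply: none; exists g.
have [g1 Gg1 [g0K g1K]] := subgroup_inv Gg0.
apply: (sub_finite_set _ (finite_image (fun g => g0 \o g) fin)).
move=> g [[Gg gE] gy]; exists (g1 \o g); last first.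
  by apply: funext => x /=; rewrite g1K.
split; first exact: GM.
move=> i; rewrite leq_eqVlt => /orP[/eqP->|si] /=; first by rewrite gy -g0y g0K.
by rewrite gE // -[X in g1 X]g0E // g0K.
Qed.

Lemma nbwalk_transitive1 : arc_transitive G -> nbwalk_transitive 1.
Proof.
move=> harc f h [fa _] [ha _].
have [g Gg [g0 g1]] := harc _ _ _ _ (fa 0 isT) (ha 0 isT).
by exists g => // -[|[|//]].
Qed.

(** * Transitivity on all s-arcs and absence of cycles *)

Hypotheses (harc : arc_transitive G)
  (hstab : forall x : Gamma, infinite_set (stabilizer G x)).

Lemma nbwalk_transitive_all s : 0 < s -> nbwalk_transitive s.
Proof.
case: s => // s _; elim: s => [|s IH]; first exact: nbwalk_transitive1.
apply: contrapT => /(rigid_walk_exists (ltn0Sn s) IH)[k kP kR].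
apply: (hstab (x := k 0)); apply: (finite_stabilizer_of_walk kP).
apply: (sub_finite_set _ (finite_set1 idfun)) => g.
exact: (rigid_fixes_id (ltn0Sn s) kP (rigid_walks IH kP kR)).
Qed.

(* Rerouting one endpoint of a closed walk gives a walk that is not closed, so
   the two cannot be conjugate. *)
Lemma nbwalk_open s f : 0 < s -> nbwalk s f -> f 0 <> f s.
Proof.
move=> s0 fP f0s.
have [x fx [x0 x2]] := third_neighbour htri (f 1) (f 0) (f 2).
have xP : nbwalk s (scons x (fun i => f (1 + i))).
  rewrite -(prednK s0); apply: nbwalk_scons; last by [].
    by apply: nbwalk_shift; rewrite add1n prednK.
  by rewrite adj_sym.
have [g _ gE] := nbwalk_transitive_all s0 fP xP.
(* [g] maps [f 0] to [x] but fixes [f s], since the two walks agree from index 1 on. *)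
apply: x0; rewrite -[LHS](gE 0) // f0s gE //.
by case: s s0 {fP xP gE f0s}.
Qed.

Lemma graph_is_tree : is_tree Gamma.
Proof.
split=> // n c [n3 cinj cadj].
have n0 : 0 < n by lia.
(* One turn around the cycle, read modulo [n], is a closed walk of length [n]. *)
pose f i := c (Ordinal (ltn_pmod i n0)).
apply: (@nbwalk_open n f) => //; last first.
  by congr c; apply: val_inj; rewrite /= modnn mod0n.
split=> i it.
  rewrite /f (_ : Ordinal (ltn_pmod i.+1 n0) = ordS (Ordinal (ltn_pmod i n0))).
    exact: cadj.
  by apply: val_inj; rewrite /= -addn1 -modnDml addn1.
(* [i] and [i + 2] differ modulo [n] because [n >= 3]. *)
move/cinj/(congr1 val) => /=; rewrite modn_small; last lia.
have [e|ne] := eqVneq i.+2 n; first by rewrite e modnn; lia.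
by rewrite modn_small; lia.
Qed.

(** * Rays and ends in the tree *)

Definition nbray f : Prop := forall s, nbwalk s f.

Lemma nbray_inj f : nbray f -> injective f.
Proof.
move=> fP.
have main i j : i < j -> f i <> f j.
  move=> ij; have := @nbwalk_open (j - i) (fun n => f (i + n)).
  rewrite addn0 subnKC; last lia.
  by apply; [lia|apply: nbwalk_shift].
by move=> i j fij; case: (ltngtP i j) => // /main; rewrite fij.
Qed.

Lemma is_rayP f : is_ray f <-> nbray f.
Proof.
split=> [[finj fa] s|fP]; first by split=> i _ // /finj; lia.
by split; [apply: nbray_inj|move=> n; apply: (fP n.+1).1].
Qed.

(** The glued walk from [f i] to [h j] has length [i + j], and a closed walk has length 0. *)
Lemma glue_disjoint f h i j : nbray f -> nbray h -> f 0 = h 0 -> f 1 <> h 1 ->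
  f i = h j -> i = 0 /\ j = 0.
Proof.
move=> fP hP fh0 fh1 fhij.
have gP := nbwalk_glue (fP i) (hP j) fh0 fh1.
have [|ij] := posnP (i + j); first by lia.
have := nbwalk_open ij gP; rewrite /glue leq0n subn0 fhij.
case: ifP => [ji|_]; last by rewrite addKn.
have j0 : j = 0 by lia.
by rewrite j0 addn0 subnn fh0.
Qed.

(** The form that equivalence of rays takes in a tree; see [ray_equivP]. *)
Definition same_tail f h : Prop := exists a b, forall n, f (a + n) = h (b + n).

Lemma same_tail_refl f : same_tail f f.
Proof. by exists 0, 0. Qed.

Lemma same_tail_sym f h : same_tail f h -> same_tail h f.
Proof. by move=> [a [b e]]; exists b, a => n; rewrite e. Qed.

Lemma same_tail_trans f h k : same_tail f h -> same_tail h k -> same_tail f k.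
Proof.
move=> [a [b e]] [c [d e']]; exists (a + c), (d + b) => n.
by rewrite -addnA e addnCA e' addnA.
Qed.

Lemma same_tail_shift a f : same_tail f (fun n => f (a + n)).
Proof. by exists a, 0. Qed.

Lemma same_tail_comp g f h : same_tail f h -> same_tail (g \o f) (g \o h).
Proof. by move=> [a [b e]]; exists a, b => n /=; rewrite e. Qed.

Lemma nbray_shift a f : nbray f -> nbray (fun n => f (a + n)).
Proof. by move=> fP s; apply: nbwalk_shift. Qed.

Lemma nbray_comp g f : G g -> nbray f -> nbray (g \o f).
Proof. by case: hG => Gaut _ _ _ Gg fP s; apply: nbwalk_comp => //; apply: Gaut. Qed.

(** Moving the start to a neighbour [y] either drops the first vertex, when [y] is the next one on
    the ray, or prepends [y]. *)
Lemma ray_from x f : nbray f -> exists h, [/\ nbray h, h 0 = x & same_tail f h].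
Proof.
move=> fP; move: x; apply: (@connected_ind _ (f 0)).
  by exists f; split=> //; apply: same_tail_refl.
move=> x y [h [hP <- fh]] hy.
have [yh1|yh1] := pselect (y = h 1).
  exists (fun n => h (1 + n)); split=> //; first exact: nbray_shift.
  exact: same_tail_trans fh (same_tail_shift _ _).
exists (scons y h); split=> //.
  move=> s; apply: (@nbwalk_le _ _ s.+1) => //.
  by apply: nbwalk_scons; rewrite // adj_sym.
by apply: (same_tail_trans fh); exists 0, 1.
Qed.

(** Restart [h] at [f 0], then cut off the common initial segment of the two rays. *)
Lemma line_of_rays f h : nbray f -> nbray h -> ~ same_tail f h ->
  exists p q, [/\ nbray p /\ nbray q, same_tail f p, same_tail h q,
                  p 0 = q 0 & p 1 <> q 1].
Proof.
move=> fP hP nfh.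
have [k [kP kf hk]] := ray_from (f 0) hP.
have /existsNP/cid[n /asboolPn nn] : ~ forall n, f n = k n.
  move=> fk; apply: nfh; apply: same_tail_trans (same_tail_sym hk).
  by exists 0, 0.
have ex : exists n, ~~ `[<f n = k n>] by exists n.
(* The first disagreement has index [m + 1], as both rays start at [f 0]; they branch at index
   [m]. *)
case: (ex_minnP ex) => -[|m] /asboolPn fkm mP; first by rewrite kf in fkm.
have fkm' : f m = k m.
  by apply: contrapT => /asboolPn/mP; rewrite ltnn.
exists (fun n => f (m + n)), (fun n => k (m + n)).
rewrite addn0 addn1; split=> //.
- by split; apply: nbray_shift.
- exact: same_tail_shift.
- exact: same_tail_trans hk (same_tail_shift _ _).
Qed.

(** Rays with different tails run, after finitely many terms, along the two halves of a line, which
    share only [p 0]. *)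
Lemma infinite_meet_same_tail f h : nbray f -> nbray h ->
  infinite_set (range f `&` range h)%classic -> same_tail f h.
Proof.
move=> fP hP; apply: contra_notP => nfh.
have [p [q [[pP qP] [a [b fp]] [c [d hq]] pq0 pq1]]] := line_of_rays fP hP nfh.
apply: (@sub_finite_set _ _ (f @` `I_(a + b) `|` h @` `I_(c + d) `|` [set p 0])%classic).
  move=> _ [[i _ <-] [j _ fhij]].
  have [ia|ia] := ltnP i (a + b); first by left; left; exists i.
  have [jc|jc] := ltnP j (c + d); first by left; right; exists j.
  have fE : f i = p (b + (i - a)) by rewrite -fp; congr f; lia.
  have hE : h j = q (d + (j - c)) by rewrite -hq; congr h; lia.
  right; move: fhij; rewrite fE hE => /esym.
  by case/(glue_disjoint pP qP pq0 pq1) => ->.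
rewrite !finite_setU; split; [split|]; try exact: finite_image.
exact: finite_set1.
Qed.

(** A third ray meeting both infinitely often shares a tail with each; conversely, [f] itself serves
    as the third ray. *)
Lemma ray_equivP f h : is_ray f -> is_ray h -> ray_equiv f h <-> same_tail f h.
Proof.
move=> fr hr; have fP := (is_rayP f).1 fr; have hP := (is_rayP h).1 hr.
split=> [[t [/is_rayP tP tf th]]|[a [b fh]]].
  apply: (@same_tail_trans _ t); last exact: infinite_meet_same_tail.
  by apply: same_tail_sym; apply: infinite_meet_same_tail.
have infr k : nbray k -> infinite_set (range k).
  move=> kP /(finite_preimage (f := k)) fin; apply: infinite_nat.
  rewrite -(preimage_range k); apply: fin => i j _ _; exact: nbray_inj.
exists f; split=> //; first by rewrite setIid; apply: infr.
apply: (contra_not _ (infr _ (nbray_shift a fP))).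
apply: sub_finite_set => _ [n _ <-]; split; first by exists (a + n).
by exists (b + n).
Qed.

Lemma end_ofE f : is_ray f -> end_of f = [set h | nbray h /\ same_tail f h]%classic.
Proof.
move=> fr; apply/seteqP; split=> h /= [hP].
  by rewrite ray_equivP //; move/is_rayP : hP.
by move=> fh; have hr := (is_rayP h).2 hP; split=> //; apply/ray_equivP.
Qed.

Lemma end_of_same_tail f h : is_ray f -> is_ray h -> same_tail f h ->
  end_of f = end_of h.
Proof.
move=> fr hr fh; rewrite !end_ofE //.
apply/seteqP; split=> k [kP fk]; split=> //.
  exact: same_tail_trans (same_tail_sym fh) fk.
exact: same_tail_trans fh fk.
Qed.

Lemma end_act_end_of g f : G g -> is_ray f -> end_act g (end_of f) = end_of (g \o f).
Proof.
move=> Gg fr; have fP := (is_rayP f).1 fr.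
have gfr : is_ray (g \o f) by apply/is_rayP/nbray_comp.
rewrite /end_act !end_ofE //; apply/seteqP; split=> [_ [k [kP fk] <-]|k [kP gfk]].
  by split; [apply: nbray_comp|apply: same_tail_comp].
have [g' Gg' [gK g'K]] := subgroup_inv Gg.
exists (g' \o k); last by apply: funext => n /=; rewrite g'K.
split; first exact: nbray_comp.
have := same_tail_comp g' gfk; congr same_tail.
by apply: funext => n /=; rewrite gK.
Qed.

(** * Limits of group elements along an ultrafilter *)

Lemma ultra_three T (U : set_system nat) (v : nat -> T) (a b c : T) :
  UltraFilter U -> U [set n | [\/ v n = a, v n = b | v n = c]]%classic ->
  exists y : T, U [set n | v n = y]%classic.
Proof.
move=> UU Uabc.
have [Ua|Ua] := in_ultra_setVsetC [set n | v n = a]%classic UU; first by exists a.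
have [Ub|Ub] := in_ultra_setVsetC [set n | v n = b]%classic UU; first by exists b.
exists c; apply: filterS (filterI Uabc (filterI Ua Ub)).
by move=> n [/= abc [na nb]]; case: abc.
Qed.

Section Limit.
Variables (u : nat -> Gamma -> Gamma) (x0 y0 : Gamma) (U : set_system nat).
Hypotheses (uG : forall n, G (u n)) (u0 : forall n, u n x0 = y0).
Context {UU : UltraFilter U}.

(** Once [u n x = y] on a set of [U], a neighbour of [x] has only three possible images there, and
    [U] selects one; this spreads from [x0] by connectedness. *)
Lemma ultra_value x : exists y, U [set n | u n x = y]%classic.
Proof.
move: x; apply: (@connected_ind _ x0).
  by exists y0; apply: filterS filterT => n _; apply: u0.
move=> x z [y Uy] xz.
have [a [b [c [_ nE]]]] := neighbours_enum htri y.
apply: (@ultra_three _ _ _ a b c); apply: filterS Uy => n /= uy.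
by apply/nE; rewrite -uy subgroup_adj.
Qed.

Variable g : Gamma -> Gamma.
Hypothesis gU : forall x, U [set n | u n x = g x]%classic.

Lemma ultra_limit_adj x y : adj (g x) (g y) = adj x y.
Proof.
have [n [/= <- <-]] := filter_ex (filterI (gU x) (gU y)).
exact: subgroup_adj.
Qed.

Lemma ultra_limit_bij : bijective g.
Proof.
have ginj : injective g.
  move=> x y; have [n [/= <- <-]] := filter_ex (filterI (gU x) (gU y)).
  exact: subgroup_injective.
(* The image is closed under adjacency: the three neighbours of [x] go to three distinct neighbours
   of [g x], hence to all of them. *)
have gsurj y : exists x, g x = y.
  move: y; apply: (@connected_ind _ (g x0)); first by exists x0.
  move=> _ z [x <-] gxz; have [a [b [c [[ab ac bc] nE]]]] := neighbours_enum htri x.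
  have ga : adj (g x) (g a) by rewrite ultra_limit_adj; apply/nE; apply: Or31.
  have gb : adj (g x) (g b) by rewrite ultra_limit_adj; apply/nE; apply: Or32.
  have gc : adj (g x) (g c) by rewrite ultra_limit_adj; apply/nE; apply: Or33.
  case: (adj_distinct3 htri ga gb gc _ _ _ gxz); try by move/ginj.
  - by exists a.
  - by exists b.
  - by exists c.
have [g' g'K] := choice gsurj.
by exists g' => // x; apply: ginj; rewrite g'K.
Qed.

Lemma ultra_agree (l : seq Gamma) : exists n, forall x, List.In x l -> u n x = g x.
Proof.
suff : U [set n | forall x, List.In x l -> u n x = g x]%classic by apply: filter_ex.
elim: l => [|x l IH]; first by apply: filterS filterT => n _ x [].
by apply: filterS (filterI (gU x) IH) => n /= [ux ul] y [<-|/ul].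
Qed.

(** [closed_group] speaks of sequences, so one is extracted from the ultrafilter: its [n]-th term
    agrees with [g] on the finite list [E n], and these lists exhaust the graph. *)
Lemma ultra_limit_closed : closed_group G -> G g.
Proof.
move=> Gcl.
have ex x : exists l : seq Gamma, forall y, adj x y -> List.In y l.
  have [a [b [c [_ nE]]]] := neighbours_enum htri x.
  by exists [:: a; b; c] => y /nE /= []->; tauto.
have [nb nbE] := choice ex.
(* [E n] contains the ball of radius [n] around [x0]. *)
pose E := fix E n : seq Gamma :=
  if n is m.+1 then E m ++ List.flat_map nb (E m) else [:: x0].
have Ecov x : exists N, forall n, N <= n -> List.In x (E n).
  move: x; apply: (@connected_ind _ x0).
    exists 0; elim=> [|n IH] _ /=; first by left.
    by apply/List.in_or_app; left; apply: IH.
  move=> x y [N NE] xy; exists N.+1 => -[//|n] Nn /=.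
  apply/List.in_or_app; right; apply/List.in_flat_map.
  by exists x; split; [apply: NE|apply: nbE].
have [phi phiE] := choice (fun n => ultra_agree (E n)).
apply: (Gcl (u \o phi)) => [n||x]; [exact: uG|exact: ultra_limit_bij|].
by have [N NE] := Ecov x; exists N => n /NE; apply: phiE.
Qed.

End Limit.

(** An ultrafilter refining the eventual filter keeps every value that is eventually constant. *)
Lemma closed_limit (u : nat -> Gamma -> Gamma) x0 y0 : closed_group G ->
  (forall n, G (u n)) -> (forall n, u n x0 = y0) ->
  exists2 g, G g & forall x y, (\forall n \near \oo, u n x = y)%classic -> g x = y.
Proof.
move=> Gcl uG u0; have [U [UU ooU]] := ultraFilterLemma eventually_filter.
have [g gU] := choice (ultra_value uG u0 (UU := UU)).
exists g; first exact: (ultra_limit_closed x0 uG gU Gcl).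
move=> x y /ooU Uy.
by have [n [/= <- <-]] := filter_ex (filterI (gU x) Uy).
Qed.

Lemma line_map f1 f2 h1 h2 : closed_group G ->
  nbray f1 -> nbray f2 -> f1 0 = f2 0 -> f1 1 <> f2 1 ->
  nbray h1 -> nbray h2 -> h1 0 = h2 0 -> h1 1 <> h2 1 ->
  exists2 g, G g & g \o f1 = h1 /\ g \o f2 = h2.
Proof.
move=> Gcl f1P f2P f0 f12 h1P h2P h0 h12.
have ex n : exists g, G g /\ forall i, i <= n -> g (f1 i) = h1 i /\ g (f2 i) = h2 i.
  (* Half-length [n.+1] rather than [n] keeps the walk of positive length when [n = 0]. *)
  have [//|||g Gg gE] := @nbwalk_transitive_all (n.+1 + n.+1) _
    (glue n.+1 f1 f2) (glue n.+1 h1 h2); [exact: nbwalk_glue..|].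
  exists g; split=> // i ni; split.
    have := gE (n.+1 - i); rewrite /glue leq_subr subKn; last lia.
    by apply; lia.
  (* At its centre [glue] reads the first ray, so index 0 of the second ray goes through the common
     origin. *)
  have [->|i0] := posnP i.
    by rewrite -f0 -h0; have := gE n.+1; rewrite /glue leqnn subnn; apply; lia.
  have := gE (n.+1 + i); rewrite /glue addKn.
  have -> : (n.+1 + i <= n.+1) = false by lia.
  by apply; lia.
have [u uE] := choice ex.
have [||g Gg gE] := @closed_limit u (f1 0) (h1 0) Gcl; [by move=> n; case: (uE n)| |].
  by move=> n; have [_ /(_ 0)[]] := uE n.
exists g => //; split; apply: funext => i /=; apply: gE; exists i => // n /= ni.
  by have [_ /(_ i ni)[]] := uE n.
by have [_ /(_ i ni)[]] := uE n.
Qed.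

(** Two distinct ends are those of the two halves of a line, so it suffices to map lines to
    lines. *)
Lemma closed_two_transitive_on_ends : closed_group G -> two_transitive_on_ends G.
Proof.
move=> Gcl _ _ _ _ [r1 r1r <-] [r2 r2r <-] [t1 t1r <-] [t2 t2r <-] r12 t12.
have line (a b : nat -> Gamma) : is_ray a -> is_ray b -> end_of a <> end_of b ->
    exists p q, [/\ is_ray p /\ is_ray q, end_of a = end_of p,
                    end_of b = end_of q, p 0 = q 0 & p 1 <> q 1].
  move=> ar br ab.
  have nab : ~ same_tail a b by move/(end_of_same_tail ar br).
  have [p [q [[/is_rayP pr /is_rayP qr] ap bq pq0 pq1]]] :=
    line_of_rays ((is_rayP a).1 ar) ((is_rayP b).1 br) nab.
  by exists p, q; split=> //; apply: end_of_same_tail.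
have [p1 [p2 [[p1r p2r] -> -> p0 p12]]] := line _ _ r1r r2r r12.
have [q1 [q2 [[q1r q2r] -> -> q0 q12]]] := line _ _ t1r t2r t12.
have [g Gg [<- <-]] := line_map Gcl ((is_rayP _).1 p1r) ((is_rayP _).1 p2r) p0 p12
  ((is_rayP _).1 q1r) ((is_rayP _).1 q2r) q0 q12.
by exists g => //; rewrite !end_act_end_of.
Qed.

End Group.

Theorem theorem3p1 (Gamma : graph) (G : set (Gamma -> Gamma))
  (hconn : connected_graph Gamma) (htri : trivalent Gamma)
  (hG : subgroup_Aut G)
  (hvert : vertex_transitive G) (harc : arc_transitive G)
  (hstab : forall x : Gamma, infinite_set (stabilizer G x)) :
  is_tree Gamma /\
  (forall s : nat, 1 <= s -> sarc_transitive G s) /\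
  (closed_group G -> two_transitive_on_ends G).
Proof.
split; first exact: (graph_is_tree hconn htri hG).
split; last exact: closed_two_transitive_on_ends.
by move=> s s0; apply/sarc_transitiveP; apply: nbwalk_transitive_all.
Qed.
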